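(* Let $\mathbb{F}_2$ be the finite field with $2$ elements, let $k=\mathbb{F}_2(x)$ be the rational function field in one variable over $\mathbb{F}_2$, and let $G=PGL_2$. Then there exist infinitely many $G(k)$-conjugacy classes of $k$-anisotropic unipotent elements in $G$.
   Context: $PGL_2$ has its standard $k$-structure, and $G(k)=PGL_2(k)$. A unipotent element $u\in G(k)$ is $k$-anisotropic if it is not contained in any proper parabolic subgroup of $G$ defined over $k$ (for $PGL_2$: it fixes no $k$-point of $\mathbb{P}^1$). The conjugacy classes in question are those of elements of $G(k)$ under conjugation by $G(k)$. *)

(* Defs.v *)
From HB Require Import structures.
From mathcomp Require Import all_boot all_order all_algebra generic_quotient.
From mathcomp Require Import boolp classical_sets cardinality.

Set Implicit Arguments.
Unset Strict Implicit.
Unset Printing Implicit Defensive.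

Import GRing.Theory.

Local Open Scope ring_scope.
Local Open Scope classical_set_scope.
Local Open Scope quotient_scope.

(* The cosets A k^* and B k^* are equal iff A B^-1 is a scalar matrix. *)
Section PGL2.
Variable k : fieldType.

Definition GL2 := {A : 'M[k]_2 | A \in unitmx}.

Definition GL2_of (A : 'M[k]_2) (uA : A \in unitmx) : GL2 := exist _ A uA.

Definition homothetic (A B : GL2) : bool :=
  is_scalar_mx (val A *m invmx (val B)).

Lemma GL2_unit (A : GL2) : val A \in unitmx. Proof. exact: valP. Qed.
Hint Resolve GL2_unit : core.

Lemma homotheticP (A B : GL2) :
  reflect (exists2 c, c != 0 & val A = c *: val B) (homothetic A B).
Proof.
apply: (iffP (is_scalar_mxP)) => -[c].
  move=> /(congr1 (mulmx^~ (val B))); rewrite mulmxKV // mul_scalar_mx => AE.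
  exists c => //; apply/eqP => c0; have := GL2_unit A.
  by rewrite AE c0 scale0r unitmxE det0 unitr0.
by move=> _ ->; exists c; rewrite -scalemxAl mulmxV // scalemx1.
Qed.

Lemma homothetic_refl : reflexive homothetic.
Proof. by move=> A; apply/homotheticP; exists 1; rewrite ?oner_eq0 ?scale1r. Qed.

Lemma homothetic_sym : symmetric homothetic.
Proof.
suff H A B : homothetic A B -> homothetic B A by move=> A B; apply/idP/idP; exact: H.
move=> /homotheticP[c c0 AE]; apply/homotheticP; exists c^-1.
  by rewrite invr_eq0.
by rewrite AE scalerA mulVf // scale1r.
Qed.

Lemma homothetic_trans : transitive homothetic.
Proof.
move=> B A C /homotheticP[c c0 AE] /homotheticP[d d0 BE]; apply/homotheticP.
by exists (c * d); rewrite ?mulf_neq0 // AE BE scalerA.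
Qed.

Canonical homothetic_equiv :=
  EquivRel homothetic homothetic_refl homothetic_sym homothetic_trans.

(* GL_2(k) / k^*, which is all of PGL_2(k) by Hilbert 90. *)
Definition PGL2 := {eq_quot homothetic}.

HB.instance Definition _ : EqQuotient GL2 homothetic PGL2 :=
  EqQuotient.on PGL2.
HB.instance Definition _ := Choice.on PGL2.

Definition PGL2_class (A : GL2) : PGL2 := \pi A.

Lemma PGL2_classP (A B : GL2) :
  PGL2_class A = PGL2_class B <-> exists2 c, c != 0 & val A = c *: val B.
Proof. by split=> [/eqmodP/homotheticP | /homotheticP/eqmodP]. Qed.

Lemma PGL2_reprK (g : PGL2) : PGL2_class (repr g) = g.
Proof. exact: reprK. Qed.

Lemma PGL2_reprP (A : GL2) :
  exists2 c, c != 0 & val (repr (PGL2_class A)) = c *: val A.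
Proof. by apply/PGL2_classP; rewrite PGL2_reprK. Qed.

Definition GL2_one : GL2 := GL2_of (unitmx1 k 2).

Lemma GL2_mul_subproof (A B : GL2) : val A *m val B \in unitmx.
Proof. by rewrite unitmx_mul !GL2_unit. Qed.
Definition GL2_mul (A B : GL2) : GL2 := GL2_of (GL2_mul_subproof A B).

Lemma GL2_inv_subproof (A : GL2) : invmx (val A) \in unitmx.
Proof. by rewrite unitmx_inv. Qed.
Definition GL2_inv (A : GL2) : GL2 := GL2_of (GL2_inv_subproof A).

Definition PGL2_one : PGL2 := PGL2_class GL2_one.
Definition PGL2_mul (g h : PGL2) : PGL2 := PGL2_class (GL2_mul (repr g) (repr h)).
Definition PGL2_inv (g : PGL2) : PGL2 := PGL2_class (GL2_inv (repr g)).

Lemma PGL2_class_mul (A B : GL2) :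
  PGL2_mul (PGL2_class A) (PGL2_class B) = PGL2_class (GL2_mul A B).
Proof.
have [c c0 Ac] := PGL2_reprP A; have [d d0 Bd] := PGL2_reprP B.
apply/PGL2_classP; exists (c * d); first by rewrite mulf_neq0.
by rewrite /= Ac Bd -scalemxAl -scalemxAr scalerA.
Qed.

Lemma PGL2_class_inv (A : GL2) :
  PGL2_inv (PGL2_class A) = PGL2_class (GL2_inv A).
Proof.
have [c c0 Ac] := PGL2_reprP A.
apply/PGL2_classP; exists c^-1; first by rewrite invr_eq0.
by rewrite /= Ac invmxZ // -Ac.
Qed.

Fact PGL2_mulA : associative PGL2_mul.
Proof.
move=> f g h; rewrite -(PGL2_reprK f) -(PGL2_reprK g) -(PGL2_reprK h).
by rewrite !PGL2_class_mul; congr PGL2_class; apply/val_inj; rewrite /= mulmxA.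
Qed.

Fact PGL2_mul1g : left_id PGL2_one PGL2_mul.
Proof.
move=> g; rewrite -(PGL2_reprK g) PGL2_class_mul; congr PGL2_class.
by apply/val_inj; rewrite /= mul1mx.
Qed.

Fact PGL2_mulVg : left_inverse PGL2_one PGL2_inv PGL2_mul.
Proof.
move=> g; rewrite -(PGL2_reprK g) PGL2_class_inv PGL2_class_mul.
by congr (PGL2_class _); apply/val_inj; rewrite /= mulVmx ?GL2_unit.
Qed.

Fact PGL2_mulg1 : right_id PGL2_one PGL2_mul.
Proof.
move=> g; rewrite -(PGL2_reprK g) PGL2_class_mul; congr PGL2_class.
by apply/val_inj; rewrite /= mulmx1.
Qed.

Fact PGL2_mulgV : right_inverse PGL2_one PGL2_inv PGL2_mul.
Proof.
move=> g; rewrite -(PGL2_reprK g) PGL2_class_inv PGL2_class_mul.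
by congr (PGL2_class _); apply/val_inj; rewrite /= mulmxV ?GL2_unit.
Qed.

HB.instance Definition _ :=
  isGroup.Build PGL2 PGL2_mulA PGL2_mul1g PGL2_mulg1 PGL2_mulVg PGL2_mulgV.

Definition PGL2_conj_class (g : PGL2) : set PGL2 :=
  [set (g ^ h)%g | h in [set: PGL2]].

(* The matrix of X |-> A X A^-1 on the space of 2 x 2 matrices; for A
   invertible, Ad is a closed embedding of algebraic groups from PGL_2 (the
   automorphism group of the algebra M_2) into GL(M_2). *)
Definition Ad (A : 'M[k]_2) : 'M[k]_(2 * 2) :=
  lin_mx (mulmx A \o mulmxr (invmx A)).

Lemma mul_vec_Ad (A X : 'M[k]_2) :
  mxvec X *m Ad A = mxvec (A *m X *m invmx A).
Proof. by rewrite mul_vec_lin /= mulmxA. Qed.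

Lemma eq_Ad (A B : 'M[k]_2) :
  (forall X, A *m X *m invmx A = B *m X *m invmx B) -> Ad A = Ad B.
Proof.
move=> AB; suff H (X : 'M_(2 * 2)) : X *m Ad A = X *m Ad B.
  by rewrite -[LHS]mul1mx H mul1mx.
by apply/row_matrixP => i; rewrite !row_mul -(vec_mxK (row i X)) !mul_vec_Ad AB.
Qed.

Lemma AdZ c (A : 'M[k]_2) : c != 0 -> A \in unitmx -> Ad (c *: A) = Ad A.
Proof.
move=> c0 Au; apply: eq_Ad => X; rewrite invmxZ; last first.
  by rewrite unitmxZ ?unitfE.
by rewrite -!scalemxAl -scalemxAr scalerA mulfV // scale1r.
Qed.

(* An element of a linear algebraic group is unipotent iff its image under a
   closed embedding into some GL_n is a unipotent matrix. *)
Definition unipotent_mx n (M : 'M[k]_n) : Prop := exists m, (M - 1) ^+ m = 0.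

Definition unipotent (g : PGL2) : Prop := unipotent_mx (Ad (val (repr g))).

(* The points of the projective line are the lines of k^2. *)
Definition P1 := {l : {vspace 'cV[k]_2} | \dim l == 1}.

Definition stabilizer (l : P1) : set PGL2 :=
  [set g | (linfun (mulmx (val (repr g))) @: val l)%VS = val l].

Lemma stabilizerP (l : P1) (A : GL2) :
  stabilizer l (PGL2_class A) <-> (linfun (mulmx (val A)) @: val l)%VS = val l.
Proof.
have [c c0 Ac] := PGL2_reprP A.
suff -> : (linfun (mulmx (val A)) @: val l)%VS =
          (linfun (mulmx (val (repr (PGL2_class A)))) @: val l)%VS by [].
apply/eqP; rewrite eqEsubv; apply/andP; split; apply/subvP => _ /memv_imgP[v vl ->].
  have -> : linfun (mulmx (val A)) v =
            linfun (mulmx (val (repr (PGL2_class A)))) (c^-1 *: v).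
    by rewrite !lfunE /= Ac -scalemxAl -scalemxAr scalerA mulfV // scale1r.
  by rewrite memv_img // memvZ.
have -> : linfun (mulmx (val (repr (PGL2_class A)))) v =
          linfun (mulmx (val A)) (c *: v).
  by rewrite !lfunE /= Ac -scalemxAl -scalemxAr.
by rewrite memv_img // memvZ.
Qed.

(* The proper parabolic k-subgroups of PGL_2 are the Borel subgroups defined
   over k, i.e. the stabilizers of the k-points of the projective line; they
   are given here through their groups of k-points. *)
Definition proper_parabolic (P : set PGL2) : Prop :=
  exists l : P1, P = stabilizer l.

Definition anisotropic (g : PGL2) : Prop :=
  forall P : set PGL2, proper_parabolic P -> ~ P g.

End PGL2.

Section UnipotentOverClosure.
Variables (k : fieldType) (L : closedFieldType) (f : {rmorphism k -> L}).

Lemma map_Ad (A : 'M[k]_2) : map_mx f (Ad A) = Ad (map_mx f A).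
Proof.
by apply: map_lin_mx => X /=; rewrite !map_mxM map_invmx.
Qed.

Lemma map_unipotent_mx n (M : 'M[k]_n) :
  unipotent_mx (map_mx f M) <-> unipotent_mx M.
Proof.
have E m : (map_mx f M - 1) ^+ m = map_mx f ((M - 1) ^+ m).
  elim: m => [|m IH]; first by rewrite !expr0 map_mx1.
  by rewrite !exprS IH map_mxM map_mxB map_mx1.
split=> -[m Hm]; exists m; last by rewrite E Hm map_mx0.
by apply: (@map_mx_inj _ _ f); rewrite -E Hm map_mx0.
Qed.

Lemma unipotent_Ad (A : 'M[L]_2) :
  A \in unitmx -> unipotent_mx A -> unipotent_mx (Ad A).
Proof.
move=> Au [m Am].
pose x : 'M[L]_(2 * 2) := lin_mx (mulmx (A - 1) \o mulmxr (invmx A)).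
pose y : 'M[L]_(2 * 2) := lin_mulmxr (invmx A - 1).
have ext (M N : 'M[L]_(2 * 2)) :
    (forall X, mxvec X *m M = mxvec X *m N) -> M = N.
  move=> MN; suff H (X : 'M_(2 * 2)) : X *m M = X *m N by rewrite -[LHS]mul1mx H mul1mx.
  by apply/row_matrixP => i; rewrite !row_mul -(vec_mxK (row i X)) MN.
have actx X : mxvec X *m x = mxvec ((A - 1) *m X *m invmx A).
  by rewrite mul_vec_lin /= mulmxA.
have acty X : mxvec X *m y = mxvec (X *m (invmx A - 1)).
  by rewrite mul_vec_lin.
have comA : GRing.comm (A - 1) (invmx A).
  apply/commr_sym/commrB; last exact: commr1.
  by rewrite /GRing.comm -!mulmxE mulVmx ?mulmxV.
have xm : x ^+ m = 0.
  have Hx j X : mxvec X *m x ^+ j = mxvec ((A - 1) ^+ j *m X *m (invmx A) ^+ j).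
    elim: j X => [|j IH] X; first by rewrite !expr0 !mulmx1 mul1mx.
    rewrite exprS -mulmxE mulmxA actx IH exprSr -mulmxE (exprS (invmx A)).
    by rewrite -!mulmxE !mulmxA.
  by apply: ext => X; rewrite Hx Am !mul0mx mulmx0 linear0.
have ym : y ^+ m = 0.
  have Hy j X : mxvec X *m y ^+ j = mxvec (X *m (invmx A - 1) ^+ j).
    elim: j X => [|j IH] X; first by rewrite !expr0 !mulmx1.
    by rewrite exprS -mulmxE mulmxA acty IH exprS -!mulmxE !mulmxA.
  apply: ext => X; rewrite Hy.
  have -> : invmx A - 1 = (A - 1) * (- invmx A).
    by rewrite mulrN mulrBl mul1r -mulmxE mulmxV // opprB.
  rewrite exprMn_comm; last exact: commrN.
  by rewrite Am mul0r !mulmx0 linear0.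
have comxy : GRing.comm x y.
  apply: ext => X; rewrite -!mulmxE !mulmxA actx acty acty actx.
  rewrite -!mulmxA; congr (mxvec (_ *m (_ *m _))).
  by rewrite mulmxBr mulmxBl mulmx1 mul1mx.
have -> : Ad A = 1 + x + y.
  apply: ext => X; rewrite mul_vec_Ad !mulmxDr mulmx1 actx acty -!linearD /=.
  congr mxvec; rewrite mulmxBl mul1mx mulmxBl mulmxBr mulmx1.
  by rewrite -addrA subrKA addrC subrK.
exists (m + m)%N; rewrite -(addrA 1) [_ - 1]addrC addKr exprDn_comm //.
rewrite big1 // => i _; have [im|mi] := leqP m i.
  by rewrite -(subnK im) exprD ym mulr0 mulr0 mul0rn.
have -> : (m + m - i = m - i + m)%N by rewrite addnBAC // ltnW.
by rewrite exprD xm mulr0 mul0r mul0rn.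
Qed.

Lemma Ad_unipotent (A : 'M[L]_2) : A \in unitmx -> unipotent_mx (Ad A) ->
  exists2 c, c != 0 & unipotent_mx (c *: A).
Proof.
move=> Au [m Hm].
have [r rE] := closed_field_poly_normal (char_poly A).
have := size_char_poly A.
rewrite rE (monicP (char_poly_monic A)) scale1r size_prod_XsubC => -[].
case: r rE => [|a [|b []]] //; rewrite (monicP (char_poly_monic A)) scale1r.
rewrite !big_cons big_nil mulr1 => rE _.
have CH : (A - a%:M) *m (A - b%:M) = 0.
  by rewrite -(Cayley_Hamilton A) rE rmorphM !rmorphB /= horner_mx_X !horner_mx_C.
have : a * b != 0.
  have -> : a * b = \det A.
    have := char_poly_det A; rewrite sqrrN expr1n mul1r => <-.
    by rewrite -horner_coef0 rE !hornerE mulrNN.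
  by rewrite -unitfE -unitmxE.
rewrite mulf_eq0 negb_or => /andP[a0 b0].
have scal z : z != 0 -> A - z%:M = 0 ->
    exists2 c, c != 0 & unipotent_mx (c *: A).
  move=> z0 /subr0_eq ->; exists z^-1; rewrite ?invr_eq0 //; exists 1%N.
  by rewrite expr1 scale_scalar_mx mulVf // subrr.
have [/scal|] := eqVneq (A - a%:M) 0; first exact.
have [/scal|] := eqVneq (A - b%:M) 0; first by move=> H _; exact: H.
move=> /matrix0Pn[i' [j' Qn0]] /matrix0Pn[i [j Pn0]].
pose X := col j' (A - b%:M) *m row i (A - a%:M).
have X0 : X != 0.
  by apply/matrix0Pn; exists i', j; rewrite mxE big_ord1 !mxE mulf_neq0 // -?mxE; move: Qn0 Pn0; rewrite !mxE.
have AX : A *m X = a *: X.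
  rewrite /X mulmxA scalemxAl; congr (_ *m _).
  rewrite colE mulmxA scalemxAl; congr (_ *m _).
  by apply/eqP; rewrite -subr_eq0 -mul_scalar_mx -mulmxBl CH.
have XA : X *m A = b *: X.
  rewrite /X -mulmxA scalemxAr; congr (_ *m _).
  rewrite rowE -mulmxA scalemxAr; congr (_ *m _).
  by apply/eqP; rewrite -subr_eq0 -mul_mx_scalar -mulmxBr CH.
have XV : X *m invmx A = b^-1 *: X.
  have : b *: (X *m invmx A) = X by rewrite scalemxAl -XA mulmxK.
  by move=> {2}<-; rewrite scalerA mulVf // scale1r.
have XAd : mxvec X *m (Ad A - 1) = (a / b - 1) *: mxvec X.
  rewrite mulmxBr mulmx1 mul_vec_Ad AX -scalemxAl XV scalerA linearZ /=.
  by rewrite scalerBl scale1r.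
have : mxvec X *m (Ad A - 1) ^+ m = (a / b - 1) ^+ m *: mxvec X.
  elim: {Hm} m => [|m IH]; first by rewrite !expr0 mulmx1 scale1r.
  by rewrite exprS -mulmxE mulmxA XAd -scalemxAl IH scalerA -exprS.
rewrite Hm mulmx0 => /esym/eqP; rewrite scaler_eq0 mxvec_eq0 (negPf X0) orbF.
rewrite expf_eq0 subr_eq0 => /andP[_ /eqP ab1].
have ab : b = a by rewrite -[b]mul1r -ab1 mulfVK.
exists a^-1; rewrite ?invr_eq0 //; exists 2.
have -> : a^-1 *: A - 1 = a^-1 *: (A - a%:M).
  by rewrite scalerBr scale_scalar_mx mulVf.
have CHa : (A - a%:M) *m (A - a%:M) = 0 by rewrite -{2}ab.
by rewrite expr2 -mulmxE -scalemxAl -scalemxAr CHa !scaler0.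
Qed.

(* Agreement with the description over an algebraic closure: a unipotent
   element of PGL_2(L) is the image of a unipotent element of GL_2(L). *)
Lemma unipotentP (A : GL2 k) :
  unipotent (PGL2_class A) <->
  exists2 c : L, c != 0 & unipotent_mx (c *: map_mx f (val A)).
Proof.
have [d d0 dA] := PGL2_reprP A.
have Au : map_mx f (val A) \in unitmx by rewrite map_unitmx GL2_unit.
rewrite /unipotent dA AdZ ?GL2_unit // -map_unipotent_mx map_Ad.
split=> [/Ad_unipotent|[c c0 Hc]]; first exact.
rewrite -(AdZ c0) //; apply: unipotent_Ad => //.
by rewrite unitmxZ ?unitfE.
Qed.

End UnipotentOverClosure.

Notation F2x := {fraction {poly 'F_2}}.

(* Main.v *)
Require Import Defs.
From mathcomp Require Import all_boot all_order all_algebra.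
From mathcomp Require Import boolp classical_sets cardinality.

Set Implicit Arguments.
Unset Strict Implicit.
Unset Printing Implicit Defensive.

Local Open Scope classical_set_scope.

(** In characteristic 2, a matrix [A] with [A^2 = b] scalar has unipotent image
in PGL_2, since [(Ad A - 1)^2 = (Ad A)^2 - 1 = 0], and this image fixes no
point of the projective line when [b] is not a square. Conjugacy in PGL_2
preserves the class of [b] modulo nonzero squares. As [1] and [x] are linearly
independent over the subfield of squares of [F_2(x)], the elements
[x + x^(2n)] are nonsquares, pairwise inequivalent modulo squares. *)

Import GRing.Theory.
Local Open Scope ring_scope.

Local Notation tofrac := (@FracField.tofrac _).

Section SquareScalar.
Variable k : fieldType.

(** The order is reversed because [Ad] acts on row vectors from the right, so the leftmost factor is
    applied first. *)
Lemma mulmx_Ad (A B : 'M[k]_2) : A \in unitmx -> B \in unitmx ->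
  Ad A *m Ad B = Ad (B *m A).
Proof.
move=> Au Bu; suff H (X : 'M[k]_(2 * 2)) : X *m (Ad A *m Ad B) = X *m Ad (B *m A).
  by rewrite -[LHS]mul1mx H mul1mx.
apply/row_matrixP => i; rewrite !row_mul -(vec_mxK (row i X)) mulmxA !mul_vec_Ad.
have -> : invmx (B *m A) = invmx A *m invmx B.
  apply: (can_inj (mulmxK Bu)); apply: (can_inj (mulmxK Au)).
  by rewrite -[LHS]mulmxA mulVmx ?unitmx_mul ?Bu // mulmxKV // mulVmx.
by rewrite !mulmxA.
Qed.

Lemma Ad1 : Ad (1%:M : 'M[k]_2) = 1%:M.
Proof.
suff H (X : 'M[k]_(2 * 2)) : X *m Ad 1%:M = X by rewrite -[LHS]mul1mx H.
apply/row_matrixP => i; rewrite row_mul -(vec_mxK (row i X)) mul_vec_Ad.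
by rewrite mul1mx invmx1 mulmx1.
Qed.

Lemma sqr_scalar_unitmx (A : 'M[k]_2) (b : k) : b != 0 ->
  A *m A = b%:M -> A \in unitmx.
Proof.
move=> b0 AA; suff /mulmx1_unit[] : A *m (b^-1 *: A) = 1%:M by [].
by rewrite -scalemxAr AA scale_scalar_mx mulVf.
Qed.

Lemma sqr_scalar_neq0 (A : GL2 k) (b : k) :
  val A *m val A = b%:M -> b != 0.
Proof.
move=> AA; have : b%:M \in @unitmx k 2 by rewrite -AA unitmx_mul GL2_unit.
by rewrite unitmxE det_scalar unitfE expf_eq0.
Qed.

Lemma unipotent_sqr_scalar (A : GL2 k) (b : k) : 2 \in [pchar k] ->
  val A *m val A = b%:M -> unipotent (PGL2_class A).
Proof.
move=> k2 AA; have [c c0 Ac] := PGL2_reprP A.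
rewrite /unipotent Ac AdZ ?GL2_unit //; exists 2.
(* The matrix ring also has characteristic 2, so squaring is additive on the commuting matrices
   [Ad A] and [1]. *)
have M2 : 2 \in [pchar 'M[k]_(2 * 2)].
  apply/andP; split=> //; apply/eqP/matrixP => i j.
  by rewrite mulr2n !mxE addrr_pchar2.
rewrite (oppr_pchar2 M2) -(pFrobenius_autE M2) pFrobenius_autD_comm; last first.
  exact: commr1.
rewrite pFrobenius_aut1 pFrobenius_autE expr2 -mulmxE mulmx_Ad ?GL2_unit // AA -scalemx1 AdZ.
- by rewrite Ad1 (addrr_pchar2 M2).
- exact: sqr_scalar_neq0 AA.
- exact: unitmx1.
Qed.

(** A fixed line is spanned by an eigenvector of [A], and its eigenvalue [t] would satisfy
    [t ^+ 2 = b]. *)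
Lemma anisotropic_sqr_scalar (A : GL2 k) (b : k) : (forall t, t ^+ 2 != b) ->
  val A *m val A = b%:M -> anisotropic (PGL2_class A).
Proof.
move=> bNsq AA _ [[l l1] ->] /stabilizerP /= Al.
have v0 : vpick l != 0 by rewrite vpick0 -dimv_eq0 (eqP l1).
have lE : l = <[vpick l]>%VS.
  apply/esym/eqP; rewrite eqEdim -memvE memv_pick (eqP l1) dim_vline.
  by rewrite v0.
have := memv_img (linfun (mulmx (val A))) (memv_pick l).
rewrite Al lfunE {2}lE => /vlineP[t At].
have : (t ^+ 2 - b) *: vpick l = 0.
  rewrite scalerBl -(mul_scalar_mx b) -AA -mulmxA At -scalemxAr At.
  by rewrite scalerA expr2 subrr.
by move/eqP; rewrite scaler_eq0 (negPf v0) orbF subr_eq0 (negPf (bNsq t)).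
Qed.

Lemma PGL2_conj_class_sqr_scalar (A B : GL2 k) (b c : k) :
    val A *m val A = b%:M -> val B *m val B = c%:M ->
    PGL2_conj_class (PGL2_class A) = PGL2_conj_class (PGL2_class B) ->
  exists2 t, t != 0 & b = t ^+ 2 * c.
Proof.
move=> AA BB AB.
have : PGL2_conj_class (PGL2_class B) (PGL2_class A).
  by rewrite -AB; exists 1%g => //; rewrite conjg1.
case=> h _; rewrite -(PGL2_reprK h); set H := repr h.
have -> : (PGL2_class B ^ PGL2_class H)%g =
    PGL2_class (GL2_mul (GL2_inv H) (GL2_mul B H)).
  by rewrite -2!PGL2_class_mul -PGL2_class_inv.
move/esym/PGL2_classP => [t t0 AE]; exists t => //.
suff : b%:M = (t ^+ 2 * c)%:M :> 'M[k]_2.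
  by move/(congr1 (fun M : 'M[k]_2 => M 0 0)); rewrite !mxE.
(* Here [A] is [t] times the conjugate of [B] by [H]. Squaring leaves [t ^+ 2] times the conjugate
   of [B *m B], which is scalar and hence unchanged by conjugation. *)
rewrite -AA AE -scalemxAl -scalemxAr scalerA -expr2 -[in RHS]scale_scalar_mx.
congr (_ *: _); have -> : val (GL2_mul (GL2_inv H) (GL2_mul B H)) =
    invmx (val H) *m (val B *m val H) by [].
rewrite !mulmxA.
rewrite mulmxK ?GL2_unit // -(mulmxA (invmx _)) BB.
by rewrite -mulmxA -scalar_mxC mulmxA mulVmx ?GL2_unit // mul1mx.
Qed.

(** The witness is the companion matrix of the polynomial [X^2 - b]. *)
Lemma exists_sqr_scalar (b : k) : b != 0 ->
  exists A : GL2 k, val A *m val A = b%:M.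
Proof.
move=> b0; pose A : 'M[k]_(1 + 1) := block_mx 0 b%:M 1 0.
have AA : A *m A = b%:M.
  rewrite mulmx_block !mul0mx !mulmx0 !mulmx1 !mul1mx !addr0 !add0r.
  by rewrite -scalar_mx_block.
by exists (GL2_of (sqr_scalar_unitmx b0 AA)).
Qed.

End SquareScalar.

(* Unless [t = 1], the relation gives [a = ((r + t s) / (1 + t))^2]. *)
Lemma sqr_ratio_pchar2 (k : fieldType) (a r s t : k) : 2 \in [pchar k] ->
    (forall u, u ^+ 2 != a) -> a + r ^+ 2 = t ^+ 2 * (a + s ^+ 2) -> r = s.
Proof.
move=> k2 aNsq E.
have sqD (y z : k) : (y + z) ^+ 2 = y ^+ 2 + z ^+ 2.
  by rewrite -!(pFrobenius_autE k2) rmorphD.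
have sq_inj (y z : k) : y ^+ 2 = z ^+ 2 -> y = z.
  move=> yz; apply/eqP; rewrite -(subr_eq0 y z) (oppr_pchar2 k2).
  by rewrite -sqrf_eq0 sqD yz addrr_pchar2.
have F : (1 + t) ^+ 2 * a = (r + t * s) ^+ 2.
  rewrite !sqD expr1n exprMn mulrDl mul1r.
  apply/eqP; rewrite -subr_eq0 (oppr_pchar2 k2) addrACA E mulrDr.
  by rewrite addrr_pchar2.
have [t1|t1] := eqVneq (1 + t) 0.
  move: E; have -> : t = 1.
    by apply/esym/eqP; rewrite -subr_eq0 (oppr_pchar2 k2) t1.
  by rewrite expr1n mul1r => /addrI /sq_inj.
case/eqP: (aNsq ((r + t * s) / (1 + t))).
by rewrite expr_div_n -F mulrAC mulfV ?mul1r // sqrf_eq0.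
Qed.

Lemma infinite_anisotropic_unipotent_classes (k : fieldType) (a : k)
    (r : nat -> k) : 2 \in [pchar k] -> (forall u, u ^+ 2 != a) ->
    injective r ->
  infinite_set [set C : set (PGL2 k) | exists u : PGL2 k,
    [/\ unipotent u, anisotropic u & C = PGL2_conj_class u]].
Proof.
move=> k2 aNsq r_inj; pose b n := a + r n ^+ 2.
have bNsq n u : u ^+ 2 != b n.
  (* If [u ^+ 2 = a + r n ^+ 2], then [(u + r n) ^+ 2 = a] in characteristic 2. *)
  apply: contraNneq (aNsq (u + r n)) => uE.
  by rewrite -!(pFrobenius_autE k2) rmorphD /= !pFrobenius_autE uE /b -addrA
    addrr_pchar2 ?addr0.
have b0 n : b n != 0.
  by have := bNsq n 0; rewrite expr0n eq_sym.
pose A n := sval (cid (exists_sqr_scalar (b0 n))).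
have AA n : val (A n) *m val (A n) = (b n)%:M.
  by rewrite /A; case: cid.
pose cl n := PGL2_conj_class (PGL2_class (A n)).
have cl_inj : injective cl.
  move=> m n /(PGL2_conj_class_sqr_scalar (AA m) (AA n))[t _].
  by move=> /(sqr_ratio_pchar2 k2 aNsq)/r_inj.
(* If the set of classes were finite, so would be its preimage under the injective [cl], which is
   all of [nat]. *)
move=> /(finite_preimage (f := cl) (in2W cl_inj)).
apply/(sub_infinite_set _ infinite_nat) => n _; exists (PGL2_class (A n)).
split=> //; first exact: unipotent_sqr_scalar (AA n).
exact: anisotropic_sqr_scalar (AA n).
Qed.

(** This clears denominators, turning an equation between fractions into one in [R]. *)
Lemma frac_numden (R : idomainType) (t : {fraction R}) :
  exists2 d : R, d != 0 & exists n : R, t * tofrac d = tofrac n.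
Proof.
elim/quotW: t => r; exists \d_r; first exact: denom_ratioP.
exists \n_r; unlock tofrac; rewrite -[LHS]FracField.pi_mul; apply/eqmodP.
rewrite /= FracField.equivfE /FracField.mulf !numden_Ratio ?(mulf_neq0, oner_neq0, denom_ratioP) //.
by rewrite !mulr1 mulrC.
Qed.

Lemma fracX_nsquare (R : idomainType) (t : {fraction {poly R}}) :
  t ^+ 2 != tofrac 'X.
Proof.
apply/eqP => tX; have [d d0 [n tn]] := frac_numden t.
have : n ^+ 2 == 'X * d ^+ 2.
  by rewrite -tofrac_eq tofracXn -tn exprMn tX tofracM tofracXn.
move/eqP=> E; have n0 : n != 0.
  by rewrite -sqrf_eq0 E mulf_neq0 ?polyX_eq0 ?sqrf_eq0.
(* The size of a nonzero polynomial is its degree plus one, so it is odd for [n ^+ 2] and even for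
   ['X * d ^+ 2]. *)
have /= := congr1 (fun p : {poly R} => odd (size p)) E.
rewrite mulrC size_mulX ?sqrf_eq0 // !expr2 !size_mul //.
move: n0 d0; rewrite -!size_poly_gt0.
by case: (size n) (size d) => [//|i] [//|j] _ _; rewrite !addSn !addnS /= !addnn !odd_double.
Qed.

Theorem proposition9p1 :
  infinite_set [set C : set (PGL2 F2x) |
    exists u : PGL2 F2x,
      [/\ unipotent u, anisotropic u & C = PGL2_conj_class u]].
Proof.
apply: (@infinite_anisotropic_unipotent_classes _ (tofrac 'X)
  (fun n => tofrac 'X^n)).
(* Characteristic 2 passes from ['F_2] to polynomials, then to fractions. *)
- apply: (rmorph_pchar tofrac); apply: (rmorph_pchar (@polyC _)).
  exact: pchar_Fp.
- exact: fracX_nsquare.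
- move=> m n /eqP; rewrite tofrac_eq => /eqP.
  by move=> /(congr1 (fun p : {poly 'F_2} => size p)); rewrite !size_polyXn => -[].
Qed.
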